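(* Let $g$ be a blow-up shock similarity profile for one of the five ODEs (E1)–(E5) listed in the context, and put $h(z)=g(-z)$. Then $h$ is a rarefaction profile for the corresponding PDE: $h$ satisfies the same ODE with the right-hand side $-\frac15\,g'z$ replaced by the opposite one (that is, with right-hand side $+\frac15\,h'z$), with $h(\pm\infty)=\pm1$, so that $u_+(x,t)=h\big(x/t^{1/5}\big)$ is a similarity solution of the corresponding PDE defined for all $t>0$. Moreover, $$u_+(\cdot,t)\to S_+\quad\text{in } L^1_{\rm loc}(\mathbb{R})\ \text{ as } t\to0^+,$$ where $S_+(x)=-1$ for $x<0$ and $S_+(x)=1$ for $x>0$.
   Context: The five PDEs are $u_t=-u\,u_{xxxxx}$, $u_t=-(u\,u_{xxxx})_x$, $u_t=-(u\,u_{xxx})_{xx}$, $u_t=-(u\,u_{xx})_{xxx}$, $u_t=-(u\,u_x)_{xxxx}$. Substituting $u(x,t)=g(z)$, $z=x/(-t)^{1/5}$, $t<0$, gives respectively the ODEs on $\mathbb{R}$: (E1) $g\,g^{(5)}=-\frac15\,g'z$; (E2) $(g\,g^{(4)})'=-\frac15\,g'z$; (E3) $(g\,g''')''=-\frac15\,g'z$; (E4) $(g\,g'')'''=-\frac15\,g'z$; (E5) $(g\,g')^{(4)}=-\frac15\,g'z$. A blow-up shock similarity profile for one of these ODEs is an odd smooth solution $g:\mathbb{R}\to\mathbb{R}$ of it (so that $g(0)=g''(0)=g^{(4)}(0)=0$) with $g(z)\to1$ as $z\to-\infty$ and $g(z)\to-1$ as $z\to+\infty$. *)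

(* Defs.v *)
From HB Require Import structures.
From mathcomp Require Import all_boot all_order all_algebra.
From mathcomp Require Import all_classical all_reals all_analysis.

Set Implicit Arguments.
Unset Strict Implicit.
Unset Printing Implicit Defensive.

Import Order.TTheory GRing.Theory Num.Theory.
Import numFieldNormedType.Exports.

Local Open Scope classical_set_scope.
Local Open Scope ring_scope.

Section ShockProfiles.
Context {R : realType}.
Implicit Types (f g h : R -> R) (u : R -> R -> R).

(* C^oo on the whole line. Since derive1n n f is a total function, the
   differentiability of every iterated derivative has to be required. *)
Definition smooth f := forall n x, derivable (derive1n n f) x 1.

(* (f f^(5-k))^(k), for k < 5: with f_x = f', the five spatial operators
   k = 0: f f_xxxxx,     k = 1: (f f_xxxx)_x,  k = 2: (f f_xxx)_xx,
   k = 3: (f f_xx)_xxx,  k = 4: (f f_x)_xxxx.                              *)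
Definition spatial_op (k : nat) f : R -> R :=
  derive1n k (fun x => f x * derive1n (5 - k) f x).

Definition similarity_ode (k : nat) (c : R) f :=
  forall z, spatial_op k f z = c * derive1 f z * z.

Definition blowup_shock_profile (k : nat) g :=
  [/\ smooth g,
      forall z, g (- z) = - g z,
      similarity_ode k (- (1 / 5)) g,
      g z @[z --> -oo] --> (1 : R) &
      g z @[z --> +oo] --> (- 1 : R)].

Definition rarefaction_profile (k : nat) h :=
  [/\ smooth h,
      similarity_ode k (1 / 5) h,
      h z @[z --> -oo] --> (- 1 : R) &
      h z @[z --> +oo] --> (1 : R)].

(* Classical solution u(x, t) of u_t = - (u u^(5-k))^(k) on R x (0, +oo):
   smooth in x, differentiable in t, with u_t and all the x-derivatives of u
   continuous in (x, t). *)
Definition pde_solution (k : nat) u :=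
  [/\ forall t : R, 0 < t -> smooth (u ^~ t),
      forall x t : R, 0 < t -> derivable (u x) t 1,
      forall n (p : R * R), 0 < p.2 ->
        {for p, continuous (fun q : R * R => derive1n n (u ^~ q.2) q.1)},
      forall p : R * R, 0 < p.2 ->
        {for p, continuous (fun q : R * R => derive1 (u q.1) q.2)} &
      forall x t : R, 0 < t -> derive1 (u x) t = - spatial_op k (u ^~ t) x].

Definition similarity_solution h : R -> R -> R :=
  fun x t => h (x / t `^ (1 / 5)).

(* The value at 0 is irrelevant in L^1_loc. *)
Definition S_plus : R -> R :=
  fun x => if x < 0 then - 1 else if 0 < x then 1 else 0.

Definition cvg_L1loc (F : set_system R) (v : R -> R -> R) (w : R -> R) :=
  [/\ \forall t \near F, locally_integrable setT (v t),
      locally_integrable setT w &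
      forall K : set R, compact K ->
        (\int[lebesgue_measure]_(x in K) `|v t x - w x|%:E)%E @[t --> F]
          --> 0%E].

End ShockProfiles.

(* Main.v *)
Require Import Defs.
From mathcomp Require Import all_boot all_order all_algebra.
From mathcomp Require Import all_classical all_reals all_analysis.
From mathcomp Require Import measurable_realfun ring lra.
Import Order.TTheory GRing.Theory Num.Theory.
Import numFieldNormedType.Exports.
Local Open Scope classical_set_scope.
Local Open Scope ring_scope.

(** The five operators [(f f^(5-k))^(k)] carry five derivatives in all, so under
a dilation [x |-> x * a] each of them is multiplied by [a^5].  With [a = -1] this
is the change of sign of the right-hand side under reflection; with
[a = t^(-1/5)] it produces the factor [1/t] of [u_t].  For the initial trace,
[x t^(-1/5)] tends to [+oo] or [-oo] with the sign of [x], and dominated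
convergence applies since [h] is bounded. *)

(** * Derivatives and the spatial operators under dilation and reflection *)

Section Scaling.
Context {R : realType}.
Implicit Types (f : R -> R) (a c x : R).

(** The prefactor [c] keeps the shape [c * f (y * a)] stable under differentiation, so that
    derivatives of higher order follow by iteration. *)
Lemma is_derive_dilate f c a x : derivable f (x * a) 1 ->
  is_derive x 1 (fun y : R => c * f (y * a)) (c * a * derive1 f (x * a)).
Proof.
move=> df.
have da : is_derive x 1 ( *%R^~ a) a.
  by apply: is_derive_eq; rewrite scaler0 add0r; exact: mulr1.
have df' : is_derive (x * a) 1 f (derive1 f (x * a)).
  by split => //; rewrite derive1E.
have dfa := @is_derive1_comp _ f ( *%R^~ a) x _ _ df' da.
have dcfa := is_deriveM (is_derive_cst c x 1) dfa.
apply: is_derive_eq.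
by rewrite scaler0 addr0 /cst -mulrA [a * _]mulrC.
Qed.

Lemma derivable_dilate f c a x : derivable f (x * a) 1 ->
  derivable (fun y : R => c * f (y * a)) x 1.
Proof. by move=> /(is_derive_dilate _ c)[]. Qed.

(* No differentiability assumption: where [f] has no derivative, [derive1] is the
   junk value [0] on both sides.  This spares the smoothness of the product in
   [spatial_op]. *)
Lemma derive1_dilate f c a x : c != 0 -> a != 0 ->
  derive1 (fun y : R => c * f (y * a)) x = c * a * derive1 f (x * a).
Proof.
move=> c0 a0; have [df|ndf] := pselect (derivable f (x * a) 1).
  by have [_ <-] := is_derive_dilate _ c _ _ df; rewrite derive1E.
have ndg : ~ derivable (fun y : R => c * f (y * a)) x 1.
  (* Dilating back by [a^-1], with prefactor [c^-1], recovers [f], so a derivative of the dilate at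
     [x] would give one of [f] at [x * a]. *)
  move=> dg; apply: ndf; rewrite (_ : f = fun y : R => c^-1 * (c * f (y * a^-1 * a))).
    by apply: (derivable_dilate (fun y : R => c * f (y * a))); rewrite mulfK.
  by apply/funext => y; rewrite mulfVK// mulKf.
rewrite !derive1E /derive (dvgP ndg) (dvgP ndf).
exact/esym/mulr0.
Qed.

Lemma derive1n_dilate n f c a : c != 0 -> a != 0 ->
  derive1n n (fun y : R => c * f (y * a)) =
  (fun y : R => c * a ^+ n * derive1n n f (y * a)).
Proof.
move=> c0 a0; elim: n => [|n IH]; first by rewrite expr0 mulr1 !derive1n0.
apply/funext => x; rewrite derive1nS IH derive1_dilate ?mulf_neq0 ?expf_neq0//.
by rewrite -derive1nS exprSr mulrA.
Qed.

Lemma derive1n_dilate1 n f a : a != 0 ->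
  derive1n n (fun y : R => f (y * a)) = (fun y : R => a ^+ n * derive1n n f (y * a)).
Proof.
move=> a0; have := @derive1n_dilate n f 1 a (oner_neq0 _) a0.
by under eq_fun do rewrite mul1r; move->; under eq_fun do rewrite mul1r.
Qed.

Lemma smooth_dilate f a : a != 0 -> smooth f -> smooth (fun y : R => f (y * a)).
Proof.
by move=> a0 sf n x; rewrite derive1n_dilate1//; exact/derivable_dilate/sf.
Qed.

Lemma spatial_op_dilate (k : 'I_5) f a x : a != 0 ->
  spatial_op k (fun y : R => f (y * a)) x = a ^+ 5 * spatial_op k f (x * a).
Proof.
move=> a0; rewrite /spatial_op derive1n_dilate1//.
(* The factor [a ^+ (5 - k)] of the inner derivative becomes the prefactor for the outer one, which
   adds [a ^+ k]; the exponents sum to 5 since [k < 5]. *)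
under [X in derive1n k X]eq_fun do rewrite mulrCA.
rewrite (derive1n_dilate k (fun y : R => f y * derive1n (5 - k) f y)) ?expf_neq0//.
by rewrite -exprD subnK// ltnW.
Qed.

Lemma smooth_continuous f n : smooth f -> continuous (derive1n n f).
Proof.
by move=> sf x; apply/differentiable_continuous/derivable1_diffP/sf.
Qed.

(** Under the dilation by -1 the operator gains the sign $(-1)^5=-1$, whereas in $f'z$ the signs
    from $f'$ and from $z$ cancel; hence [c] changes sign. *)
Lemma similarity_ode_reflect (k : 'I_5) c f : similarity_ode k c f ->
  similarity_ode k (- c) (fun z => f (- z)).
Proof.
move=> odef z.
have -> : (fun y : R => f (- y)) = (fun y : R => f (y * -1)).
  by apply/funext => y; rewrite mulrN1.
have N10 : (-1 : R) != 0 by rewrite oppr_eq0 oner_neq0.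
rewrite spatial_op_dilate// odef -[in RHS]derive1n1 derive1n_dilate1// derive1n1.
ring.
Qed.

End Scaling.

(** * Self-similar functions as classical solutions for $t>0$ *)

Section SelfSimilar.
Context {R : realType}.
Implicit Types (h : R -> R) (t x b : R).

Lemma powR_fifth_exp5 t : 0 < t -> (t `^ (- (1 / 5))) ^+ 5 = t^-1.
Proof.
move=> t0; rewrite -powR_mulrn ?powR_ge0// -powRrM.
rewrite (_ : _ * _ = -1); last by field.
by rewrite powR_inv1// ltW.
Qed.

Lemma similarity_solutionE h x t :
  similarity_solution h x t = h (x * t `^ (- (1 / 5))).
Proof. by rewrite powRN. Qed.

Lemma is_derive_similarity h x t b : 0 < t ->
  derivable h (x * t `^ b) 1 ->
  is_derive t 1 (fun s => h (x * s `^ b))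
    (derive1 h (x * t `^ b) * (x * (b * t `^ (b - 1)))).
Proof.
move=> t0 dh.
have dh' : is_derive (x * t `^ b) 1 h (derive1 h (x * t `^ b)).
  by split => //; rewrite derive1E.
have dp : is_derive t 1 (fun s => x * s `^ b) (x * (b * t `^ (b - 1))).
  have dxp := is_deriveM (is_derive_cst x t 1) (is_derive1_powR b t0).
  by apply: is_derive_eq; rewrite scaler0 addr0.
exact: (@is_derive1_comp _ h (fun s => x * s `^ b) t _ _ dh' dp).
Qed.

(** The exponent is kept general because $u_t$ involves both $-1/5$ and $-1/5-1$. *)
Lemma continuous_powR_snd b (p : R * R) : 0 < p.2 ->
  {for p, continuous (fun q : R * R => q.2 `^ b)}.
Proof.
move=> p0; apply: (@continuous_comp _ _ _ snd (fun s : R => s `^ b)).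
  exact: cvg_snd.
apply/differentiable_continuous/derivable1_diffP.
by have [] := is_derive1_powR b p0.
Qed.

Lemma continuous_similarity h b (p : R * R) : continuous h -> 0 < p.2 ->
  {for p, continuous (fun q : R * R => h (q.1 * q.2 `^ b))}.
Proof.
move=> ch p0; apply: (@continuous_comp _ _ _ (fun q : R * R => q.1 * q.2 `^ b) h).
  by apply: cvgM; [exact: cvg_fst|exact: continuous_powR_snd].
exact: ch.
Qed.

(** Continuity is local and the upper half-plane is open. This transfers continuity from explicit
    formulas, valid only for $t>0$, to the derivatives themselves. *)
Lemma continuous_upper_half (F G : R * R -> R) (p : R * R) : 0 < p.2 ->
  (forall q, 0 < q.2 -> F q = G q) -> {for p, continuous F} ->
  {for p, continuous G}.
Proof.
move=> p0 FG; rewrite /prop_for /continuous_at FG//; apply: cvg_trans.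
apply: near_eq_cvg.
have : \forall q \near p, 0 < q.2.
  have snd_p : (q : R * R).2 @[q --> p] --> p.2 by exact: cvg_snd.
  exact: snd_p _ (lt_nbhsr p0).
by apply: filterS => q /FG.
Qed.

Lemma similarity_pde_solution (k : 'I_5) h : smooth h ->
  similarity_ode k (1 / 5) h -> pde_solution k (similarity_solution h).
Proof.
move=> sh odeh.
have ux t : (similarity_solution h) ^~ t = (fun x => h (x * t `^ (- (1 / 5)))).
  by apply/funext => x; rewrite similarity_solutionE.
have ut x : similarity_solution h x = (fun t => h (x * t `^ (- (1 / 5)))).
  by apply/funext => t; rewrite similarity_solutionE.
have s0 t : 0 < t -> t `^ (- (1 / 5)) != 0 by move=> t0; rewrite gt_eqF ?powR_gt0.
have dt x t (t0 : 0 < t) := is_derive_similarity h x t (- (1 / 5)) t0 (sh 0 _).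
have dtE x t : 0 < t -> derive1 (similarity_solution h x) t =
    derive1 h (x * t `^ (- (1 / 5))) *
      (x * (- (1 / 5) * t `^ (- (1 / 5) - 1))).
  by move=> t0; rewrite ut derive1E; have [_ ->] := dt x t t0.
split.
- by move=> t t0; rewrite ux; apply: smooth_dilate => //; exact: s0.
- by move=> x t t0; rewrite ut; have [] := dt x t t0.
- move=> n p p0.
  apply: (@continuous_upper_half (fun q => (q.2 `^ (- (1 / 5))) ^+ n *
    derive1n n h (q.1 * q.2 `^ (- (1 / 5))))) => //.
    by move=> q q0; rewrite ux derive1n_dilate1//; exact: s0.
  apply: cvgM; last by apply: continuous_similarity => //; exact: smooth_continuous.
  apply: (@continuous_comp _ _ _ (fun q : R * R => q.2 `^ (- (1 / 5)))
    (fun y : R => y ^+ n)).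
    exact: continuous_powR_snd.
  exact: exprn_continuous.
- move=> p p0.
  apply: (@continuous_upper_half (fun q => derive1 h (q.1 * q.2 `^ (- (1 / 5))) *
    (q.1 * (- (1 / 5) * q.2 `^ (- (1 / 5) - 1))))) => //.
    by move=> q q0; rewrite dtE.
  apply: cvgM; first by apply: continuous_similarity => //; exact: (smooth_continuous _ 1).
  apply: cvgM; first exact: cvg_fst.
  by apply: cvgM; [exact: cvg_cst|exact: continuous_powR_snd].
(* With $y=xt^{-1/5}$, the chain rule gives $u_t=-\frac15h'(y)\,x\,t^{-1/5-1}$ and the ODE turns the
   operator into $t^{-1}\cdot\frac15h'(y)\,y$; splitting $t^{-1/5-1}=t^{-1/5}/t$ matches them. *)
- move=> x t t0; rewrite dtE// ux spatial_op_dilate ?s0// odeh powR_fifth_exp5//.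
  rewrite powRB; last by rewrite (gt_eqF t0) implybT.
  rewrite powRr1 ?ltW//.
  ring.
Qed.

(** * Boundedness of the profile and pointwise initial trace *)

Lemma continuous_bounded_of_cvg h (l1 l2 : R) : continuous h ->
  h z @[z --> -oo] --> l1 -> h z @[z --> +oo] --> l2 ->
  exists M, forall z, `|h z| <= M.
Proof.
move=> ch h1 h2.
have lt_add1 (l : R) : `|l| < `|l| + 1 by rewrite ltrDl.
have [A [_ hA]] := cvgr_norm_lt _ h1 _ (lt_add1 l1).
have [B [_ hB]] := cvgr_norm_lt _ h2 _ (lt_add1 l2).
have /compact_bounded[C [_ hC]] : compact (h @` `[A, B]).
  apply: continuous_compact; last exact: segment_compact.
  exact: continuous_subspaceT.
(* The limits control [h] left of [A] and right of [B], compactness controls it on [[A, B]]; the sum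
   dominates all three bounds. Any number above [C] bounds [h] on the segment, and [|C| + 1] is one
   that is also positive. *)
exists ((`|l1| + 1) + (`|l2| + 1) + (`|C| + 1)) => z.
have l10 := normr_ge0 l1; have l20 := normr_ge0 l2; have C0 := normr_ge0 C.
have [zA|Az] := ltP z A; first by have /ltW := hA _ zA; move=> /= ?; lra.
have [Bz|zB] := ltP B z; first by have /ltW := hB _ Bz; move=> /= ?; lra.
have /(_ (h z)) : forall y, (h @` `[A, B]) y -> `|y| <= `|C| + 1.
  by apply: hC; rewrite (le_lt_trans (ler_norm C)).
suff : (h @` `[A, B]) (h z) by move=> hz /(_ hz) ?; lra.
by exists z => //=; rewrite in_itv/= Az zB.
Qed.

Lemma powR_neg_cvgy b : b < 0 -> t `^ b @[t --> 0^'+] --> +oo.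
Proof.
move=> b0; rewrite -[b]opprK; under eq_fun do rewrite powRN.
apply/(@cvgrVy _ _ _ _ (fun t => t `^ (- b))).
  by near=> t; rewrite powR_gt0//; near: t; exact: nbhs_right_gt.
by apply: powR_cvg0; rewrite oppr_gt0.
Unshelve. all: by end_near. Qed.

(** Since [h 0 = 0] is also the value of [S_plus] at 0, the convergence holds at every point, the
    origin included. *)
Lemma similarity_solution_cvg h x : h 0 = 0 ->
  h z @[z --> -oo] --> (- 1 : R) -> h z @[z --> +oo] --> (1 : R) ->
  similarity_solution h x t @[t --> 0^'+] --> S_plus x.
Proof.
move=> h0 hN hP.
under eq_fun do rewrite similarity_solutionE.
have sy : t `^ (- (1 / 5)) @[t --> (0 : R)^'+] --> +oo.
  by apply: powR_neg_cvgy; lra.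
rewrite /S_plus; case: ltgtP => x0.
- apply: (cvg_comp (fun t : R => x * t `^ (- (1 / 5))) h _ hN); apply/cvgNry.
  rewrite (_ : - _ = fun t : R => - x * t `^ (- (1 / 5))); last first.
    by apply/funext => t; rewrite mulNr.
  by apply: gt0_cvgMry => //; rewrite oppr_gt0.
- by apply: (cvg_comp (fun t : R => x * t `^ (- (1 / 5))) h _ hP); exact: gt0_cvgMry.
- by rewrite x0; under eq_fun do rewrite mul0r h0; exact: cvg_cst.
Qed.

(** * Local integrability and convergence in $L^1_{\rm loc}$ *)

Lemma measurable_S_plus : measurable_fun setT (@S_plus R).
Proof.
apply: measurable_fun_ifT => //; first exact: measurable_fun_ltr.
by apply: measurable_fun_ifT => //; exact: measurable_fun_ltr.
Qed.

Lemma bounded_locally_integrable (f : R -> R) M :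
  measurable_fun setT f -> (forall x, `|f x| <= M) ->
  locally_integrable setT f.
Proof.
move=> mf fM; split => //; first exact: openT.
move=> K _ cK.
have : lebesgue_measure.-integrable K (EFin \o f).
  apply: measurable_bounded_integrable.
  - exact: compact_measurable.
  - exact: compact_finite_measure.
  - exact: measurable_funTS.
  - exists M; split; first exact: num_real.
    by move=> N MN y _; exact: le_trans (fM y) (ltW MN).
by case/integrableP.
Qed.

Lemma S_plus_bounded (x : R) : `|S_plus x| <= 1.
Proof. by rewrite /S_plus; case: ltgtP; rewrite ?normrN ?normr1 ?normr0. Qed.

Lemma similarity_cvg_L1loc h : continuous h -> h 0 = 0 ->
  h z @[z --> -oo] --> (- 1 : R) -> h z @[z --> +oo] --> (1 : R) ->
  cvg_L1loc 0^'+ (fun t x => similarity_solution h x t) S_plus.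
Proof.
move=> ch h0 hN hP.
have [M hM] := continuous_bounded_of_cvg _ _ _ ch hN hP.
have mu t : measurable_fun setT (fun x => similarity_solution h x t).
  apply: continuous_measurable_fun => x.
  apply: (@continuous_comp _ _ _ (fun y : R => y / t `^ (1 / 5)) h); last exact: ch.
  exact: mulrr_continuous.
split.
- by near=> t; apply: (@bounded_locally_integrable _ M) => // x; exact: hM.
- exact: (@bounded_locally_integrable _ 1 measurable_S_plus S_plus_bounded).
(* Dominated convergence concerns sequences, so the right limit at 0 is tested along positive
   sequences [u n] tending to 0. *)
move=> K cK; apply/cvge_at_rightP => u [u0 ucvg].
have mK := compact_measurable cK.
have mD n : measurable_fun K (fun x =>
    `|similarity_solution h x (u n) - S_plus x|).
  apply/measurable_funTS/measurableT_comp => //.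
  by apply: measurable_funB => //; exact: measurable_S_plus.
(* The dominating constant adds the bound [M] of [h] to the bound 1 of [S_plus]; it is integrable
   because [K] is compact. *)
have [] := @dominated_convergence _ _ _ lebesgue_measure K mK
  (fun n x => `|similarity_solution h x (u n) - S_plus x|%:E) (cst 0%E)
  (cst (M + 1)%:E).
- by move=> n; apply/measurable_EFinP; exact: mD.
- exact: measurable_cst.
- apply: aeW => x _; apply: cvg_EFin; first exact: nearW.
  rewrite -(normr0 R) -(subrr (S_plus x)); apply: cvg_norm; apply: cvgB; last exact: cvg_cst.
  have /cvg_at_rightP := similarity_solution_cvg h x h0 hN hP.
  exact.
- apply: (@continuous_compact_integrable _ (cst (M + 1)) K cK).
  by apply: continuous_subspaceT => x; exact: cvg_cst.
- apply: aeW => x n _ /=; rewrite lee_fin normr_id (le_trans (ler_normB _ _))//.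
  by rewrite lerD ?S_plus_bounded//; exact: hM.
by move=> _ _; rewrite integral0.
Unshelve. all: by end_near. Qed.

End SelfSimilar.

Theorem mainTheorem3 (R : realType) (k : 'I_5) (g : R -> R)
    (hg : blowup_shock_profile k g) :
  let h := fun z : R => g (- z) in
  let u := similarity_solution h in
  [/\ rarefaction_profile k h,
      pde_solution k u &
      cvg_L1loc 0^'+ (fun t x => u x t) S_plus].
Proof.
move=> h u; case: hg => sg og odeg gN gP.
have N10 : (-1 : R) != 0 by rewrite oppr_eq0 oner_neq0.
have sh : smooth h.
  rewrite /h; under eq_fun do rewrite -mulrN1.
  exact: smooth_dilate.
have odeh : similarity_ode k (1 / 5) h.
  by rewrite -[1 / 5]opprK; exact: similarity_ode_reflect.
have hN : h z @[z --> -oo] --> (- 1 : R) by apply: (cvg_comp -%R g _ gP); apply/cvgNry.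
have hP : h z @[z --> +oo] --> (1 : R) by apply: (cvg_comp -%R g _ gN); apply/cvgNrNy.
have h0 : h 0 = 0.
  (* Oddness at 0 gives $h(0)+h(0)=0$, and 2 is nonzero. *)
  by apply/eqP; rewrite -[_ == _](mulrn_eq0 _ 2) mulr2n -{1}[0]oppr0 /h oppr0 og addNr.
split => //; first exact: similarity_pde_solution.
exact: (similarity_cvg_L1loc _ (smooth_continuous _ 0 sh)).
Qed.
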